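(* Let $n\ge 2$, let $s_n\colon C_n\otimes A\to A\otimes C_n$ be an upper triangular twisting map, let $\gamma^i_j$ ($i\ge 0$, $0\le j<n$) be the family of $k$-linear endomorphisms of $A$ associated with $s_n$, and let $\alpha:=\gamma^1_1$. Consider the map $F\colon A\otimes A\to {}_{\alpha}A_{\alpha^n}$ defined by $$F(a\otimes b):=\sum_{i=2}^{n-1}\gamma^1_i(a)\gamma^i_n(b),\qquad\text{where}\qquad \gamma^i_n:=\sum_{\substack{u_1,\dots,u_i\ge 1\\ u_1+\cdots+u_i=n}}\gamma^1_{u_1}\circ\cdots\circ\gamma^1_{u_i}\quad\text{for } i\ge 2.$$ Then $F$ is a normalized cocycle in the canonical Hochschild cochain complex of $A$ with coefficients in ${}_{\alpha}A_{\alpha^n}$. Moreover, there exists an upper triangular twisting map $s_{n+1}\colon C_{n+1}\otimes A\to A\otimes C_{n+1}$ with the same $\gamma^1_j$'s as $s_n$ for $j=0,\dots,n-1$ if and only if $[F]=0$ in $H^2(A,{}_{\alpha}A_{\alpha^n})$. In this case $F=-\mathrm{b}^2(\gamma^1_n)$, where $\gamma^1_n$ is the corresponding map associated with $s_{n+1}$ and $\mathrm{b}^2$ is the Hochschild coboundary.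
   Context: $k$ is a commutative ring; all algebras are associative unital $k$-algebras, all maps are $k$-linear and $\otimes$ means $\otimes_k$. $A$ is a $k$-algebra and $C_m:=k[y]/\langle y^m\rangle$. A twisting map is a $k$-linear map $s\colon C_m\otimes A\to A\otimes C_m$ such that (1) $s(1\otimes a)=a\otimes 1$ and $s(c\otimes 1)=1\otimes c$; (2) $s\circ(\mu_{C_m}\otimes A)=(A\otimes\mu_{C_m})\circ(s\otimes C_m)\circ(C_m\otimes s)$; (3) $s\circ(C_m\otimes\mu_A)=(\mu_A\otimes C_m)\circ(A\otimes s)\circ(s\otimes A)$, where $\mu$ denotes multiplication and an algebra symbol also denotes its identity map. The family associated with $s$ is given by $s(y^r\otimes a)=\sum_{j=0}^{m-1}\gamma^r_j(a)\otimes y^j$ for $0\le r<m$, and $\gamma^r_j:=0$ for $r\ge m$, $0\le j<m$. The twisting map is called upper triangular if $\gamma^1_0=0$; in that case $\alpha:=\gamma^1_1$ is an algebra endomorphism of $A$ and $\alpha^n$ is its $n$-fold composition. ${}_{\alpha}A_{\alpha^n}$ is the $k$-module $A$ with $A$-bimodule structure $a\cdot b\cdot c:=\alpha(a)\,b\,\alpha^n(c)$. The Hochschild coboundaries with these coefficients are $\mathrm{b}^2(\delta)(a\otimes b)=\alpha(a)\delta(b)-\delta(ab)+\delta(a)\alpha^n(b)$ for $\delta\colon A\to A$, and $\mathrm{b}^3(G)(a\otimes b\otimes c)=\alpha(a)G(b\otimes c)-G(ab\otimes c)+G(a\otimes bc)-G(a\otimes b)\alpha^n(c)$ for $G\colon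 A\otimes A\to A$. A $2$-cochain is normalized if it vanishes on $a\otimes b$ whenever $a=1$ or $b=1$. *)

(* Defs.v *)
From HB Require Import structures.
From mathcomp Require Import all_boot all_order all_algebra.
From mathcomp Require Import boolp.

Set Implicit Arguments.
Unset Strict Implicit.
Unset Printing Implicit Defensive.

Import GRing.Theory.
Local Open Scope ring_scope.
Local Open Scope quotient_scope.

Reserved Notation "u ⊗ v" (at level 40, left associativity).
Reserved Notation "M ⊗[ k ] N"
  (at level 40, k at level 0, left associativity, format "M  ⊗[ k ]  N").

Section Tensor.
Variables (k : comNzRingType) (M N : lmodType k).

(* A list of pairs stands for the sum of the corresponding pure tensors.
   Negatives need no generator of their own, since - (u ⊗ v) = (- u) ⊗ v. *)
Inductive tensor_rel : seq (M * N) -> seq (M * N) -> Prop :=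
| TRefl x : tensor_rel x x
| TSym x y : tensor_rel x y -> tensor_rel y x
| TTrans y x z : tensor_rel x y -> tensor_rel y z -> tensor_rel x z
| TCat x x' y y' :
    tensor_rel x x' -> tensor_rel y y' -> tensor_rel (x ++ y) (x' ++ y')
| TSwap x y : tensor_rel (x ++ y) (y ++ x)
| TAddl u u' v : tensor_rel [:: (u + u', v)] [:: (u, v); (u', v)]
| TAddr u v v' : tensor_rel [:: (u, v + v')] [:: (u, v); (u, v')]
| TScale (c : k) u v : tensor_rel [:: (c *: u, v)] [:: (u, c *: v)]
| TZero v : tensor_rel [:: (0, v)] [::].

Definition tensor_eq : rel (seq (M * N)) := fun x y => `[< tensor_rel x y >].

Fact tensor_eq_refl : reflexive tensor_eq.
Proof. by move=> x; apply/asboolP; apply: TRefl. Qed.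

Fact tensor_eq_sym : symmetric tensor_eq.
Proof. by move=> x y; apply/idP/idP => /asboolP/TSym/asboolP. Qed.

Fact tensor_eq_trans : transitive tensor_eq.
Proof.
by move=> y x z /asboolP xy /asboolP yz; apply/asboolP; apply: TTrans xy yz.
Qed.

Canonical tensor_equiv :=
  EquivRel tensor_eq tensor_eq_refl tensor_eq_sym tensor_eq_trans.

Definition tensor := {eq_quot tensor_equiv}.
HB.instance Definition _ : EqQuotient _ tensor_equiv tensor :=
  EqQuotient.on tensor.
HB.instance Definition _ := Choice.on tensor.

Lemma tensorP (x y : seq (M * N)) :
  (\pi_tensor x = \pi_tensor y) <-> tensor_rel x y.
Proof.
by split=> [/eqmodP/asboolP|xy] //; apply/eqmodP/asboolP.
Qed.

Lemma tensor_reprP (x : seq (M * N)) : tensor_rel (repr (\pi_tensor x)) x.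
Proof. by apply/tensorP; rewrite reprK. Qed.

Definition tensor_zero : tensor := \pi_tensor [::].
Definition tensor_add (s t : tensor) : tensor := \pi_tensor (repr s ++ repr t).
Definition scale_pairs (c : k) (x : seq (M * N)) :=
  [seq (c *: p.1, p.2) | p <- x].
Definition tensor_scale (c : k) (t : tensor) : tensor :=
  \pi_tensor (scale_pairs c (repr t)).
Definition tensor_opp (t : tensor) : tensor := tensor_scale (- 1) t.

Lemma scale_pairs_rel c x y :
  tensor_rel x y -> tensor_rel (scale_pairs c x) (scale_pairs c y).
Proof.
elim=> {x y} [x|x y _|y x z _ xy _|x x' y y' _ xx _ yy|x y|u u' v|u v v'|d u v|v].
- exact: TRefl.
- exact: TSym.
- exact: TTrans.
- by rewrite /scale_pairs !map_cat; apply: TCat.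
- by rewrite /scale_pairs !map_cat; apply: TSwap.
- by rewrite /= scalerDr; apply: TAddl.
- exact: TAddr.
- by rewrite /= scalerA mulrC -scalerA; apply: TScale.
- by rewrite /= scaler0; apply: TZero.
Qed.

Lemma tensor_addE x y :
  tensor_add (\pi_tensor x) (\pi_tensor y) = \pi_tensor (x ++ y).
Proof. by apply/tensorP; apply: TCat; exact: tensor_reprP. Qed.

Lemma tensor_scaleE c x :
  tensor_scale c (\pi_tensor x) = \pi_tensor (scale_pairs c x).
Proof. by apply/tensorP; apply/scale_pairs_rel/tensor_reprP. Qed.

Fact tensor_addA : associative tensor_add.
Proof.
elim/quotW=> x; elim/quotW=> y; elim/quotW=> z.
by rewrite (tensor_addE x y) (tensor_addE y z) !tensor_addE catA.
Qed.

Fact tensor_addC : commutative tensor_add.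
Proof.
elim/quotW=> x; elim/quotW=> y; rewrite !tensor_addE.
by apply/tensorP; apply: TSwap.
Qed.

Fact tensor_add0 : left_id tensor_zero tensor_add.
Proof. by elim/quotW=> x; rewrite tensor_addE. Qed.

Lemma tensor_rel_scaleD (a b : k) x :
  tensor_rel (scale_pairs (a + b) x) (scale_pairs a x ++ scale_pairs b x).
Proof.
elim: x => [|[u v] x IHx]; first exact: TRefl.
rewrite /= scalerDl -cat1s.
apply: TTrans (TCat (TAddl _ _ _) IHx) _ => /=.
move: (scale_pairs a x) (scale_pairs b x) (_, v) (_, v) => X Y q p.
have -> : p :: X ++ q :: Y = [:: p] ++ (X ++ [:: q]) ++ Y by rewrite -catA.
apply: (@TCat [:: p] _ (([:: q] ++ X) ++ Y)); first exact: TRefl.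
by apply: TCat; [apply: TSwap | apply: TRefl].
Qed.

Lemma tensor_rel_scale0 x : tensor_rel (scale_pairs 0 x) [::].
Proof.
elim: x => [|[u v] x IHx]; first exact: TRefl.
by rewrite /= scale0r -cat1s; apply: (TCat (TZero v) IHx).
Qed.

Lemma scale_pairs1 x : scale_pairs 1 x = x.
Proof. by elim: x => //= -[u v] x ->; rewrite scale1r. Qed.

Fact tensor_addN : left_inverse tensor_zero tensor_opp tensor_add.
Proof.
elim/quotW=> x; rewrite /tensor_opp tensor_scaleE tensor_addE.
apply/tensorP; rewrite -[X in _ ++ X]scale_pairs1.
apply: TTrans (TSym (tensor_rel_scaleD _ _ _)) _.
by rewrite addNr; apply: tensor_rel_scale0.
Qed.

HB.instance Definition _ := GRing.isZmodule.Build tensor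
  tensor_addA tensor_addC tensor_add0 tensor_addN.

Fact tensor_scaleA a b t :
  tensor_scale a (tensor_scale b t) = tensor_scale (a * b) t.
Proof.
elim/quotW: t => x.
rewrite (tensor_scaleE b) !tensor_scaleE /scale_pairs -map_comp.
by congr (\pi_tensor _); apply: eq_map => p /=; rewrite scalerA.
Qed.

Fact tensor_scale1 : left_id 1 tensor_scale.
Proof. by elim/quotW=> x; rewrite tensor_scaleE scale_pairs1. Qed.

Fact tensor_scaleDr : right_distributive tensor_scale +%R.
Proof.
move=> a; elim/quotW=> x; elim/quotW=> y.
rewrite [\pi_tensor x + _]tensor_addE !tensor_scaleE [RHS]tensor_addE.
by rewrite /scale_pairs map_cat.
Qed.

Fact tensor_scaleDl t : {morph tensor_scale^~ t : a b / a + b}.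
Proof.
move=> a b; elim/quotW: t => x; rewrite !tensor_scaleE [RHS]tensor_addE.
by apply/tensorP; apply: tensor_rel_scaleD.
Qed.

HB.instance Definition _ := GRing.Zmodule_isLmodule.Build k tensor
  tensor_scaleA tensor_scale1 tensor_scaleDr tensor_scaleDl.

Definition pure_tensor (u : M) (v : N) : tensor := \pi_tensor [:: (u, v)].

End Tensor.

Notation "M ⊗[ k ] N" := (@tensor k M N) : type_scope.
Notation "M ⊗[ k ] N" := (@tensor k M N) : ring_scope.
Notation "u ⊗ v" := (pure_tensor u v) : ring_scope.

Definition is_bilinear (k : comNzRingType) (M N P : lmodType k)
    (f : M -> N -> P) : Prop :=
  (forall v, linear (f^~ v)) /\ (forall u, linear (f u)).

Section TensorTheory.
Variables (k : comNzRingType) (M N P : lmodType k).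

Lemma pure_tensorDl (u u' : M) (v : N) : (u + u') ⊗ v = u ⊗ v + u' ⊗ v.
Proof. by rewrite [RHS]tensor_addE; apply/tensorP; apply: TAddl. Qed.

Lemma pure_tensorDr (u : M) (v v' : N) : u ⊗ (v + v') = u ⊗ v + u ⊗ v'.
Proof. by rewrite [RHS]tensor_addE; apply/tensorP; apply: TAddr. Qed.

Lemma pure_tensorZl c (u : M) (v : N) : (c *: u) ⊗ v = c *: (u ⊗ v).
Proof. by rewrite [RHS]tensor_scaleE. Qed.

Lemma pure_tensorZr c (u : M) (v : N) : u ⊗ (c *: v) = c *: (u ⊗ v).
Proof.
by rewrite [RHS]tensor_scaleE; apply/tensorP; apply/TSym; apply: TScale.
Qed.

Lemma pure_tensor_bilinear : is_bilinear (@pure_tensor k M N).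
Proof.
split=> [v c u u'|u c v v'].
  by rewrite pure_tensorDl pure_tensorZl.
by rewrite pure_tensorDr pure_tensorZr.
Qed.

Lemma tensor_sum (t : M ⊗[k] N) : t = \sum_(p <- repr t) p.1 ⊗ p.2.
Proof.
rewrite -[LHS]reprK; elim: (repr t) => [|[u v] x IHx]; first by rewrite big_nil.
by rewrite big_cons /= -IHx [RHS]tensor_addE.
Qed.

Lemma linear_tensor_ext (f g : {linear M ⊗[k] N -> P}) :
  (forall u v, f (u ⊗ v) = g (u ⊗ v)) -> f =1 g.
Proof.
move=> fg t; rewrite [t]tensor_sum !raddf_sum.
by apply: eq_bigr => p _; apply: fg.
Qed.

Definition tensor_lift (f : M -> N -> P) (t : M ⊗[k] N) : P :=
  \sum_(p <- repr t) f p.1 p.2.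

Section Lift.
Variables (f : M -> N -> P) (fL : is_bilinear f).

Lemma tensor_rel_lift x y : tensor_rel x y ->
  \sum_(p <- x) f p.1 p.2 = \sum_(p <- y) f p.1 p.2.
Proof.
have fDl v u u' : f (u + u') v = f u v + f u' v.
  by have := fL.1 v 1 u u'; rewrite !scale1r.
have fDr u v v' : f u (v + v') = f u v + f u v'.
  by have := fL.2 u 1 v v'; rewrite !scale1r.
have f0l v : f 0 v = 0 by apply: (addIr (f 0 v)); rewrite -fDl !add0r.
have f0r u : f u 0 = 0 by apply: (addIr (f u 0)); rewrite -fDr !add0r.
elim=> {x y} [//|x y _ -> //|y x z _ -> _ -> //|x x' y y' _ xx _ yy|x y
  |u u' v|u v v'|c u v|v]; rewrite ?big_cat ?big_cons ?big_nil /= ?addr0 //.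
- by rewrite xx yy.
- by rewrite addrC.
- have := fL.1 v c u 0; rewrite !addr0 /= f0l addr0 => ->.
  by have := fL.2 u c v 0; rewrite !addr0 /= f0r addr0 => ->.
Qed.

Lemma tensor_liftE u v : tensor_lift f (u ⊗ v) = f u v.
Proof.
by rewrite /tensor_lift (tensor_rel_lift (tensor_reprP _)) big_seq1.
Qed.

Lemma tensor_lift_linear : linear (tensor_lift f).
Proof.
move=> c; elim/quotW=> x; elim/quotW=> y.
have liftE z : tensor_lift f (\pi_(M ⊗[k] N) z) = \sum_(p <- z) f p.1 p.2.
  exact: tensor_rel_lift (tensor_reprP z).
rewrite [c *: _]tensor_scaleE [_ + _]tensor_addE !liftE big_cat /=.
congr (_ + _); rewrite /scale_pairs big_map scaler_sumr.
apply: eq_bigr => -[u v] _ /=.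
have f0l : f 0 v = 0.
  by apply: (addIr (f 0 v)); have := fL.1 v 1 0 0; rewrite !scale1r !addr0 add0r.
by have := fL.1 v c u 0; rewrite !addr0 /= f0l addr0.
Qed.

End Lift.

End TensorTheory.

Section TensorMaps.
Variable k : comNzRingType.

Section Functoriality.
Variables (M M' N N' : lmodType k).
Variables (f : {linear M -> M'}) (g : {linear N -> N'}).

Definition tensor_map : M ⊗[k] N -> M' ⊗[k] N' :=
  tensor_lift (fun u v => f u ⊗ g v).

Fact tensor_map_bilinear : is_bilinear (fun u v => f u ⊗ g v).
Proof.
split=> [v c u u'|u c v v']; rewrite linearP.
  exact: (pure_tensor_bilinear _ _).1.
exact: (pure_tensor_bilinear _ _).2.
Qed.

Fact tensor_map_linear : linear tensor_map.
Proof. exact/tensor_lift_linear/tensor_map_bilinear. Qed.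

HB.instance Definition _ :=
  GRing.isLinear.Build k (M ⊗[k] N) (M' ⊗[k] N') _ tensor_map tensor_map_linear.

Lemma tensor_mapE u v : tensor_map (u ⊗ v) = f u ⊗ g v.
Proof. exact: (tensor_liftE tensor_map_bilinear). Qed.

End Functoriality.

Section Associativity.
Variables (M N P : lmodType k).

Definition tensor_assoc : (M ⊗[k] N) ⊗[k] P -> M ⊗[k] (N ⊗[k] P) :=
  tensor_lift (fun t w => tensor_lift (fun u v => u ⊗ (v ⊗ w)) t).

Definition tensor_assocV : M ⊗[k] (N ⊗[k] P) -> (M ⊗[k] N) ⊗[k] P :=
  tensor_lift (fun u t => tensor_lift (fun v w => (u ⊗ v) ⊗ w) t).

Fact assoc_inner_bilinear w :
  is_bilinear (fun (u : M) (v : N) => u ⊗ (v ⊗ w : N ⊗[k] P)).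
Proof.
split=> [v c u u'|u c v v'].
  by rewrite pure_tensorDl pure_tensorZl.
by rewrite pure_tensorDl pure_tensorZl pure_tensorDr pure_tensorZr.
Qed.

Fact assoc_outer_bilinear : is_bilinear
  (fun (t : M ⊗[k] N) (w : P) => tensor_lift (fun u v => u ⊗ (v ⊗ w)) t).
Proof.
split=> [w|t c w w']; first exact/tensor_lift_linear/assoc_inner_bilinear.
rewrite /tensor_lift scaler_sumr -big_split; apply: eq_bigr => p _ /=.
by rewrite !(pure_tensorDr, pure_tensorZr).
Qed.

Fact assocV_inner_bilinear u :
  is_bilinear (fun (v : N) (w : P) => (u ⊗ v : M ⊗[k] N) ⊗ w).
Proof.
split=> [w c v v'|v c w w'].
  by rewrite pure_tensorDr pure_tensorZr pure_tensorDl pure_tensorZl.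
by rewrite pure_tensorDr pure_tensorZr.
Qed.

Fact assocV_outer_bilinear : is_bilinear
  (fun (u : M) (t : N ⊗[k] P) => tensor_lift (fun v w => (u ⊗ v) ⊗ w) t).
Proof.
split=> [t c u u'|u]; last exact/tensor_lift_linear/assocV_inner_bilinear.
rewrite /tensor_lift scaler_sumr -big_split; apply: eq_bigr => p _ /=.
by rewrite !(pure_tensorDl, pure_tensorZl).
Qed.

HB.instance Definition _ := GRing.isLinear.Build k _ _ _ tensor_assoc
  (tensor_lift_linear assoc_outer_bilinear).
HB.instance Definition _ := GRing.isLinear.Build k _ _ _ tensor_assocV
  (tensor_lift_linear assocV_outer_bilinear).

Lemma tensor_assocE u v w : tensor_assoc ((u ⊗ v) ⊗ w) = u ⊗ (v ⊗ w).
Proof.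
rewrite /tensor_assoc (tensor_liftE assoc_outer_bilinear).
exact: (tensor_liftE (assoc_inner_bilinear w)).
Qed.

Lemma tensor_assocVE u v w : tensor_assocV (u ⊗ (v ⊗ w)) = (u ⊗ v) ⊗ w.
Proof.
rewrite /tensor_assocV (tensor_liftE assocV_outer_bilinear).
exact: (tensor_liftE (assocV_inner_bilinear u)).
Qed.

End Associativity.

Section Multiplication.
Variable A : algType k.

Definition tensor_mul : A ⊗[k] A -> A := tensor_lift (fun a b : A => a * b).

Fact mul_bilinear : is_bilinear (fun a b : A => a * b).
Proof.
split=> [b c a a'|a c b b']; first by rewrite mulrDl scalerAl.
by rewrite mulrDr scalerAr.
Qed.

HB.instance Definition _ := GRing.isLinear.Build k _ _ _ tensor_mul
  (tensor_lift_linear mul_bilinear).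

Lemma tensor_mulE a b : tensor_mul (a ⊗ b) = a * b.
Proof. exact: (tensor_liftE mul_bilinear). Qed.

End Multiplication.

End TensorMaps.

Notation mu A := (@tensor_mul _ A).

Section Hochschild.
Variables (k : comNzRingType) (A : algType k) (phi psi : {linear A -> A}).

(* Coboundaries with coefficients in the k-module A carrying the bimodule
   structure a . b . c := phi a * b * psi c, where phi and psi are algebra
   endomorphisms. *)
Definition hoch_b2 (d : {linear A -> A}) : {linear A ⊗[k] A -> A} :=
  (mu A \o tensor_map phi d) \- (d \o mu A) \+ (mu A \o tensor_map d psi).

Definition hoch_b3 (G : {linear A ⊗[k] A -> A}) :
    {linear A ⊗[k] (A ⊗[k] A) -> A} :=
  (mu A \o tensor_map phi G)
  \- (G \o tensor_map (mu A) idfun \o @tensor_assocV k A A A)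
  \+ (G \o tensor_map idfun (mu A))
  \- (mu A \o tensor_map G psi \o @tensor_assocV k A A A).

Lemma hoch_b2E d a b :
  hoch_b2 d (a ⊗ b) = phi a * d b - d (a * b) + d a * psi b.
Proof. by rewrite /= !tensor_mapE !tensor_mulE. Qed.

Lemma hoch_b3E G a b c :
  hoch_b3 G (a ⊗ (b ⊗ c)) =
    phi a * G (b ⊗ c) - G ((a * b) ⊗ c) + G (a ⊗ (b * c)) - G (a ⊗ b) * psi c.
Proof. by rewrite /= tensor_assocVE !(tensor_mapE, tensor_mulE) /= !tensor_mulE. Qed.

Definition cocycle2 (G : {linear A ⊗[k] A -> A}) : Prop := hoch_b3 G =1 \0.

(* [G] = 0 in H^2 = ker b^3 / im b^2, for a cocycle G. *)
Definition null_class2 (G : {linear A ⊗[k] A -> A}) : Prop :=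
  exists d : {linear A -> A}, G =1 hoch_b2 d.

End Hochschild.

Definition normalized2 (k : comNzRingType) (A : algType k)
    (G : {linear A ⊗[k] A -> A}) : Prop :=
  forall a : A, G (1 ⊗ a) = 0 /\ G (a ⊗ 1) = 0.

(* k[y]/<y^m>, with y written 'qX. The library quotient {poly %/ h} is k[X]/<h>
   only for h monic of positive degree, so m >= 1 is needed. *)
Notation truncpoly k m := {poly %/ ('X^m : {poly k})}.

Section Twisting.
Variables (k : comNzRingType) (A : algType k) (m : nat).
Local Notation C := (truncpoly k m).

Definition twisting_map (s : {linear C ⊗[k] A -> A ⊗[k] C}) : Prop :=
  [/\ (forall a : A, s (1 ⊗ a) = a ⊗ 1) /\ (forall c : C, s (c ⊗ 1) = 1 ⊗ c),
      s \o tensor_map (mu C) idfun =1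
        tensor_map idfun (mu C) \o @tensor_assoc k A C C
          \o tensor_map s idfun \o @tensor_assocV k C A C
          \o tensor_map idfun s \o @tensor_assoc k C C A
    & s \o tensor_map idfun (mu A) =1
        tensor_map (mu A) idfun \o @tensor_assocV k A A C
          \o tensor_map idfun s \o @tensor_assoc k A C A
          \o tensor_map s idfun \o @tensor_assocV k C A A].

(* Only the values gamma r j with j < m are constrained. *)
Definition associated_family (s : {linear C ⊗[k] A -> A ⊗[k] C})
    (gamma : nat -> nat -> {linear A -> A}) : Prop :=
  (forall r (a : A), (r < m)%N ->
     s (('qX ^+ r : C) ⊗ a) = \sum_(j < m) gamma r j a ⊗ ('qX ^+ j : C)) /\
  (forall r j, (m <= r)%N -> (j < m)%N -> gamma r j =1 \0).

Definition upper_triangular (gamma : nat -> nat -> {linear A -> A}) : Prop :=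
  gamma 1%N 0%N =1 \0.

End Twisting.

Section Obstruction.
Variables (k : comNzRingType) (A : algType k).
Implicit Types gamma : nat -> nat -> {linear A -> A}.

Fixpoint lin_iter (n : nat) (f : {linear A -> A}) : {linear A -> A} :=
  if n is n'.+1 then f \o lin_iter n' f else idfun.

Fixpoint gamma_comp gamma (u : seq nat) : {linear A -> A} :=
  if u is j :: u' then gamma 1%N j \o gamma_comp gamma u' else idfun.

(* The parts of a composition of n are at most n, hence the range 'I_n.+1. *)
Definition gamma_top gamma (n i : nat) (a : A) : A :=
  \sum_(u : i.-tuple 'I_n.+1 |
          all (fun j : 'I_n.+1 => (1 <= j)%N) u && (\sum_(j <- u) j == n)%N)
    gamma_comp gamma [seq nat_of_ord j | j <- u] a.

Fact gamma_top_linear gamma n i : linear (gamma_top gamma n i).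
Proof.
move=> c a b; rewrite /gamma_top scaler_sumr -big_split.
by apply: eq_bigr => u _; rewrite linearP.
Qed.

HB.instance Definition _ gamma n i := GRing.isLinear.Build k A A _
  (gamma_top gamma n i) (gamma_top_linear gamma n i).

Definition obstruction gamma (n : nat) (t : A ⊗[k] A) : A :=
  \sum_(2 <= i < n) mu A (tensor_map (gamma 1%N i) (gamma_top gamma n i) t).

Fact obstruction_linear gamma n : linear (obstruction gamma n).
Proof.
move=> c s t; rewrite /obstruction scaler_sumr -big_split.
by apply: eq_bigr => i _; rewrite linearP linearP.
Qed.

HB.instance Definition _ gamma n := GRing.isLinear.Build k (A ⊗[k] A) A _
  (obstruction gamma n) (obstruction_linear gamma n).

Lemma obstructionE gamma n a b :
  obstruction gamma n (a ⊗ b) =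
    \sum_(2 <= i < n) gamma 1%N i a * gamma_top gamma n i b.
Proof.
by apply: eq_bigr => i _; rewrite tensor_mapE tensor_mulE.
Qed.

End Obstruction.

Definition upper_triangular_extension (k : comNzRingType) (A : algType k)
    (n : nat) (gamma : nat -> nat -> {linear A -> A})
    (s' : {linear truncpoly k n.+1 ⊗[k] A -> A ⊗[k] truncpoly k n.+1})
    (gamma' : nat -> nat -> {linear A -> A}) : Prop :=
  [/\ twisting_map s', associated_family s' gamma', upper_triangular gamma'
    & forall j, (j < n)%N -> gamma' 1%N j =1 gamma 1%N j].

(* Main.v *)
From HB Require Import structures.
Require Import Defs.
From mathcomp Require Import all_boot all_order all_algebra.
From mathcomp Require Import zify.

Set Implicit Arguments.
Unset Strict Implicit.
Unset Printing Implicit Defensive.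

Import GRing.Theory.
Local Open Scope ring_scope.

(** An upper triangular twisting map on k[y]/<y^m> is determined by its first
    row g_j := gamma^1_j with 0 < j < m. Think of the g_j as the coefficients
    of a power series g(y) = g_1 y + g_2 y^2 + ... over the ring of linear
    endomorphisms of A. Compatibility of s with the multiplication of
    k[y]/<y^m> says exactly that gamma^r_j is the coefficient of y^j in
    g(y)^r, written [pow_coef g r j] below. Since g has no constant term, this
    coefficient vanishes for j < r, so that the relation y^m = 0 holds for
    free. Compatibility with the unit and the product of A reduces to the
    conditions [upper_twist_coefs g m]
        g_j(1) = (j == 1),  g_j(a b) = sum_(i <= j) g_i(a) [g^i]_j(b)  (j < m),
    because the same conditions for all powers g^r follow from them by
    induction on r ([pow_coef_one], [pow_coefM]). The two directions of this
    dictionary are [upper_twist_coefs_of_map] and [twisting_map_of_coefs].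

    Passing from n to n + 1 therefore means choosing one new endomorphism g_n
    that satisfies the two conditions at j = n. Separating the terms i = 1 and
    i = n of the product condition at j = n turns it into
        g_n(a b) = alpha(a) g_n(b) + F(a, b) + g_n(a) alpha^n(b),
    that is F = - b^2(g_n) ([upper_twist_coefsS]); the condition g_n(1) = 0 is
    automatic, since evaluating F = b^2(d) at 1 (x) 1 gives d(1) = 0. This
    makes sense before g_n is chosen: for r >= 2 the coefficient of y^n in
    g(y)^r involves only the g_p with p < n ([pow_coef_congr]). For the same
    reason the product formula for g^r at y^n is already available for r >= 2,
    and expanding F(a, b c) with it gives the cocycle identity
    ([middle_sum_cocycle]). *)

(** * Coefficients of powers of a series of endomorphisms *)

Lemma sum_antidiagonals (V : nmodType) (N : nat) (F : nat -> nat -> V) :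
  \sum_(j < N) \sum_(p < j.+1) F p (j - p)%N =
  \sum_(p < N) \sum_(q < N - p) F p q.
Proof.
elim: N => [|N IHN]; first by rewrite !big_ord0.
rewrite big_ord_recr /= IHN [in RHS]big_ord_recr /= subSnn big_ord1.
rewrite big_ord_recr /= subnn addrA; congr (_ + _).
rewrite -big_split; apply: eq_bigr => p _ /=.
by rewrite subSn 1?ltnW // big_ord_recr.
Qed.

Section PowerCoefficients.
Variables (k : comNzRingType) (A : algType k).
Implicit Types g : nat -> {linear A -> A}.

(** The coefficient of y^j in the r-th power of the formal series
    sum_p g_p y^p, whose coefficients multiply by composition. *)
Fixpoint pow_coef g (r j : nat) (a : A) : A :=
  if r is r'.+1 then \sum_(p < j.+1) g p (pow_coef g r' (j - p) a)
  else a *+ (j == 0)%N.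

Fact pow_coef_linear g r j : linear (pow_coef g r j).
Proof.
elim: r j => [|r IHr] j c a b /=.
  by case: (j == 0)%N; rewrite ?mulr1n // !mulr0n scaler0 addr0.
rewrite scaler_sumr -big_split; apply: eq_bigr => p _ /=.
by rewrite IHr linearP.
Qed.

HB.instance Definition _ g r j :=
  GRing.isLinear.Build k A A _ (pow_coef g r j) (pow_coef_linear g r j).

Lemma pow_coef0E g j a : pow_coef g 0 j a = a *+ (j == 0)%N.
Proof. by []. Qed.

Lemma pow_coef1E g j : pow_coef g 1 j =1 g j.
Proof.
move=> a; rewrite /= big_ord_recr /= subnn big1 ?add0r // => p _.
by rewrite subn_eq0 leqNgt ltn_ord raddf0.
Qed.

(** The coefficientwise form of g^(r + t) = g^r g^t. *)
Lemma pow_coefD g r t j a :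
  pow_coef g (r + t) j a =
  \sum_(l < j.+1) pow_coef g r l (pow_coef g t (j - l) a).
Proof.
elim: r j => [|r IHr] j.
  rewrite big_ord_recl /= subn0 big1 ?addr0 // => l _.
transitivity (\sum_(l < j.+1) \sum_(p < l.+1)
    g p (pow_coef g r (l - p) (pow_coef g t (j - (p + (l - p))) a))).
  rewrite (sum_antidiagonals j.+1 (fun p q =>
    g p (pow_coef g r q (pow_coef g t (j - (p + q)) a)))) /=.
  apply: eq_bigr => -[p /= lepj] _; rewrite IHr raddf_sum -subSn //.
  by apply: eq_bigr => q _; rewrite subnDA.
by apply: eq_bigr => l _; apply: eq_bigr => p _; rewrite subnKC // -ltnS.
Qed.

(** What remains of the axioms of a twisting map on k[y]/<y^m> once all rows
    are expressed through the first one: upper triangularity, and the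
    compatibility of s (y (x) -) with the unit and the product of A. *)
Definition upper_twist_coefs g m : Prop :=
  [/\ g 0%N =1 \0,
      forall j, (j < m)%N -> g j 1 = (j == 1)%:R
    & forall j a b, (j < m)%N ->
        g j (a * b) = \sum_(i < j.+1) g i a * pow_coef g i j b].

Section ZeroConstantTerm.
Variable g : nat -> {linear A -> A}.
Hypothesis g0 : g 0%N =1 \0.

Lemma pow_coef_eq0 r j a : (j < r)%N -> pow_coef g r j a = 0.
Proof.
elim: r j => // r IHr j ltjr /=; rewrite big_ord_recl g0 add0r big1 // => p _.
by rewrite IHr ?raddf0 //; have := ltn_ord p; rewrite /= /bump /=; lia.
Qed.

Lemma pow_coef_diag r a : pow_coef g r r a = lin_iter r (g 1%N) a.
Proof.
elim: r => [|r IHr]; first by rewrite /= mulr1n.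
rewrite /= 2!big_ord_recl g0 add0r /= subn1 /= IHr big1 ?addr0 // => p _.
by rewrite pow_coef_eq0 ?raddf0 // /bump /=; have := ltn_ord p; lia.
Qed.

Lemma sum_pow_coef_widen N j (x : nat -> A) b : (j < N)%N ->
  \sum_(i < j.+1) x i * pow_coef g i j b = \sum_(i < N) x i * pow_coef g i j b.
Proof.
move=> ltjN; rewrite (big_ord_widen N (fun i => x i * pow_coef g i j b)) //.
rewrite big_mkcond; apply: eq_bigr => i _ /=; case: ifP => // /negbT.
by rewrite -leqNgt => /pow_coef_eq0 ->; rewrite mulr0.
Qed.

(** As g_0 = 0, a composition of j into r >= 2 positive parts has no part
    equal to j, and [g^r]_j depends only on the g_p with p < j. The bound
    j < m + (1 < r) therefore admits j = m as soon as r >= 2. *)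
Lemma pow_coef_congr g' m r j : (forall p, (p < m)%N -> g p =1 g' p) ->
  (0 < m)%N -> (j < m + (1 < r))%N -> pow_coef g r j =1 pow_coef g' r j.
Proof.
move=> eq_gg' m_gt0; elim: r j => // r IHr j ltj a /=.
have g'0 : g' 0%N =1 \0 by move=> b; rewrite -eq_gg'.
rewrite big_ord_recl [RHS]big_ord_recl g0 g'0; congr (_ + _).
apply: eq_bigr => -[p /= ltpj] _; rewrite /bump add1n.
have [lt_pm | le_mp] := ltnP p.+1 m.
  by rewrite IHr ?eq_gg' //; move: ltj; case: (r) => [|[]] /=; lia.
have [r_gt0 ->] : (0 < r)%N /\ (j - p.+1)%N = 0%N.
  by move: ltj; case: (r) => [|r1] /=; lia.
by rewrite -IHr ?addn_gt0 ?m_gt0 // pow_coef_eq0 ?raddf0 //.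
Qed.

End ZeroConstantTerm.

Section UpperTwistCoefs.
Variables (g : nat -> {linear A -> A}) (m : nat).
Hypothesis gP : upper_twist_coefs g m.
Let g0 : g 0%N =1 \0 := let: And3 h _ _ := gP in h.
Let g1 j (ltjm : (j < m)%N) : g j 1 = (j == 1)%:R :=
  let: And3 _ h _ := gP in h j ltjm.
Let gM j a b (ltjm : (j < m)%N) :
    g j (a * b) = \sum_(i < j.+1) g i a * pow_coef g i j b :=
  let: And3 _ _ h := gP in h j a b ltjm.

(** The series g sends 1 to y, hence g^r sends 1 to y^r. *)
Lemma pow_coef_one r j : (j < m + (1 < r))%N -> pow_coef g r j 1 = (r == j)%:R.
Proof.
elim: r j => [|r IHr] j ltj /=; first by rewrite eq_sym.
transitivity
  (\sum_(p < j.+1) ((p == 1 :> nat) && (r == j - p :> nat))%N%:R : A).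
  apply: eq_bigr => -[p /= lepj] _.
  have [-> | p_gt0] := posnP p; first by rewrite g0.
  have [lt_pm | le_mp] := ltnP p m.
    rewrite IHr; last by move: ltj; case: (r) => [|[]] /=; lia.
    by case: eqP => _; rewrite ?andbT ?g1 // ?andbF raddf0.
  have [r_gt0 ->] : (0 < r)%N /\ (j - p)%N = 0%N.
    by move: ltj; case: (r) => [|r1] /=; lia.
  by rewrite pow_coef_eq0 // raddf0 [r == 0]gtn_eqF // andbF.
case: j ltj => [|j] ltj; first by rewrite big_ord1.
by rewrite 2!big_ord_recl add0r big1 ?addr0 //= subn1 eqSS.
Qed.

(** Iterating the product rule: writing g^(r+1) = g g^r, apply the rule for
    g^r, then the rule for g to each resulting product
    [g^r]_q(a) [g^q]_(j-p)(b). The second factors recombine by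
    g^l g^q = g^(l+q). *)
Lemma pow_coefM r j a b : (j < m + (1 < r))%N ->
  pow_coef g r j (a * b) = \sum_(i < j.+1) pow_coef g r i a * pow_coef g i j b.
Proof.
elim: r j a b => [|r IHr] j a b ltj.
  rewrite big_ord_recl /= big1 ?addr0 => [|i _]; last by rewrite mul0r.
  by rewrite mulr1n mulrnAr.
pose G l q p :=
  g l (pow_coef g r q a) * pow_coef g l p (pow_coef g q (j - p) b).
have step (p : 'I_j.+1) : g p (pow_coef g r (j - p) (a * b)) =
    \sum_(q < j.+1) \sum_(l < j.+1) G l q p.
  case: p => p /=; rewrite ltnS => lepj.
  have [-> | p_gt0] := posnP p.
    rewrite g0 big1 // => q _; rewrite big1 // => -[[|l] ltl] _.
      by rewrite /G g0 mul0r.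
    by rewrite /G (@pow_coef_eq0 g g0 l.+1) ?mulr0.
  have [lt_pm | le_mp] := ltnP p m.
    rewrite IHr; last by move: ltj; case: (r) => [|[]] /=; lia.
    rewrite (@sum_pow_coef_widen g g0 j.+1 (j - p)
      (fun i => pow_coef g r i a)) ?ltnS ?leq_subr // raddf_sum.
    apply: eq_bigr => q _ /=; rewrite gM //.
    by rewrite (@sum_pow_coef_widen g g0 j.+1 p
      (fun i => g i (pow_coef g r q a))).
  (* p >= m forces p = j = m, a case reached only for r + 1 >= 2 *)
  have [r_gt0 jp0] : (0 < r)%N /\ (j - p)%N = 0%N.
    by move: ltj; case: (r) => [|r1] /=; lia.
  rewrite jp0 pow_coef_eq0 // raddf0 big1 // => -[[|q] ltq] _;
    rewrite big1 // => l _.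
    by rewrite /G pow_coef_eq0 // raddf0 mul0r.
  by rewrite /G jp0 (@pow_coef_eq0 g g0 q.+1) // raddf0 mulr0.
rewrite [LHS]/= (eq_bigr _ (fun p _ => step p)).
transitivity (\sum_(t < j.+1) \sum_(l < t.+1)
    g l (pow_coef g r (t - l) a) * pow_coef g (l + (t - l)) j b); last first.
  apply: eq_bigr => t _; rewrite /= mulr_suml; apply: eq_bigr => l _.
  by rewrite subnKC // -ltnS.
rewrite (sum_antidiagonals j.+1 (fun l q =>
  g l (pow_coef g r q a) * pow_coef g (l + q) j b)).
transitivity (\sum_(l < j.+1) \sum_(q < j.+1)
    g l (pow_coef g r q a) * pow_coef g (l + q) j b).
  rewrite exchange_big /= [RHS]exchange_big; apply: eq_bigr => q _ /=.
  rewrite exchange_big; apply: eq_bigr => l _ /=.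
  by rewrite pow_coefD mulr_sumr.
apply: eq_bigr => l _.
rewrite [RHS](big_ord_widen j.+1 (fun q =>
  g l (pow_coef g r q a) * pow_coef g (l + q) j b)) ?leq_subr //.
rewrite [RHS]big_mkcond; apply: eq_bigr => q _ /=; case: ifP => // le.
by rewrite (@pow_coef_eq0 g g0 (l + q)) ?mulr0 //; lia.
Qed.

End UpperTwistCoefs.
End PowerCoefficients.

(** * Sums over compositions *)

Section Compositions.
Variables (k : comNzRingType) (A : algType k).
Variable gamma : nat -> nat -> {linear A -> A}.
Hypothesis g0 : gamma 1%N 0%N =1 \0.

(** Splitting off the first part of a composition matches the recursion of
    [pow_coef]; the parts equal to 0, which the recursion also admits,
    contribute nothing since gamma^1_0 = 0. *)
Lemma sum_compositions N i j a : (j <= N)%N ->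
  \sum_(u : i.-tuple 'I_N.+1 |
          all (fun p : 'I_N.+1 => (1 <= p)%N) u && (\sum_(p <- u) p == j)%N)
    gamma_comp gamma [seq nat_of_ord p | p <- u] a = pow_coef (gamma 1%N) i j a.
Proof.
elim: i j => [|i IHi] j lejN.
  rewrite (eq_bigl (fun u => (u == [tuple]) && (j == 0)%N)) => [|u]; last first.
    by rewrite tuple0 /= big_nil eq_sym.
  rewrite /= big_mkcondr (big_pred1 [tuple]) //=.
  by case: (j == 0)%N; rewrite ?mulr1n.
pose h (z : 'I_N.+1 * i.-tuple 'I_N.+1) := [tuple of z.1 :: z.2].
rewrite (reindex h) /=; last first.
  exists (fun u : i.+1.-tuple _ => (thead u, [tuple of behead u])) => /= u _.
    by case: u => p u; congr (_, _); apply/val_inj.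
  by rewrite /h /= -tuple_eta.
pose positive (u : i.-tuple 'I_N.+1) := all (fun p : 'I_N.+1 => (1 <= p)%N) u.
rewrite (eq_bigl (fun z : 'I_N.+1 * i.-tuple 'I_N.+1 =>
  ((0 < z.1) && (z.1 <= j)) &&
  (positive z.2 && (\sum_(p <- z.2) p == j - z.1)%N))%N); last first.
  move=> [p u]; rewrite /positive /= big_cons.
  case: (all _ u); rewrite ?andbF ?andbT //=.
  by case: (0 < p)%N => //=; lia.
rewrite -(pair_big_dep (fun p : 'I_N.+1 => (0 < p) && (p <= j))%N
  (fun (p : 'I_N.+1) (u : i.-tuple 'I_N.+1) =>
    positive u && (\sum_(q <- u) q == j - p)%N)
  (fun (p : 'I_N.+1) (u : i.-tuple 'I_N.+1) =>
    gamma 1%N p (gamma_comp gamma [seq nat_of_ord p | p <- tval u] a))) /=.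
under eq_bigr => p _ do rewrite -raddf_sum IHi ?(leq_trans (leq_subr _ _)) //.
rewrite (big_ord_widen N.+1
  (fun p => gamma 1%N p (pow_coef (gamma 1%N) i (j - p) a))) //.
rewrite [RHS](bigID (fun p : 'I_N.+1 => 0 < p)%N) /= [X in _ + X]big1 ?addr0.
  by apply: eq_bigl => p; rewrite andbC ltnS.
by move=> p; rewrite -eqn0Ngt => /andP[_ /eqP->]; rewrite g0.
Qed.

Lemma gamma_topE n i a : gamma_top gamma n i a = pow_coef (gamma 1%N) i n a.
Proof. exact: sum_compositions. Qed.

End Compositions.

(** * Tensors and truncated polynomials *)

Section TensorTruncPoly.
Variables (k : comNzRingType).

Section Sums.
Variables (M N : lmodType k).

Lemma pure_tensor0l (v : N) : (0 : M) ⊗ v = 0.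
Proof. by rewrite -[X in X ⊗ v](scale0r (0 : M)) pure_tensorZl scale0r. Qed.

Lemma pure_tensor0r (u : M) : u ⊗ (0 : N) = 0.
Proof. by rewrite -[X in u ⊗ X](scale0r (0 : N)) pure_tensorZr scale0r. Qed.

Lemma pure_tensor_suml (I : Type) (r : seq I) (E : I -> M) (v : N) :
  (\sum_(i <- r) E i) ⊗ v = \sum_(i <- r) E i ⊗ v.
Proof.
apply: (big_morph (fun u : M => u ⊗ v)) => [u u'|].
  exact: pure_tensorDl.
by rewrite pure_tensor0l.
Qed.

Lemma pure_tensor_sumr (I : Type) (r : seq I) (u : M) (E : I -> N) :
  u ⊗ (\sum_(i <- r) E i) = \sum_(i <- r) u ⊗ E i.
Proof.
apply: (big_morph (fun v : N => u ⊗ v)) => [v v'|].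
  exact: pure_tensorDr.
by rewrite pure_tensor0r.
Qed.

End Sums.

Section TripleTensors.
Variables (M N P Q : lmodType k).

Lemma linear_tensor3_ext (f g : {linear (M ⊗[k] N) ⊗[k] P -> Q}) :
  (forall u v w, f ((u ⊗ v) ⊗ w) = g ((u ⊗ v) ⊗ w)) -> f =1 g.
Proof.
move=> fg; apply: linear_tensor_ext => t w; rewrite [t]tensor_sum.
by rewrite pure_tensor_suml !raddf_sum; apply: eq_bigr => p _; apply: fg.
Qed.

Lemma linear_tensor3r_ext (f g : {linear M ⊗[k] (N ⊗[k] P) -> Q}) :
  (forall u v w, f (u ⊗ (v ⊗ w)) = g (u ⊗ (v ⊗ w))) -> f =1 g.
Proof.
move=> fg; apply: linear_tensor_ext => u t; rewrite [t]tensor_sum.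
by rewrite pure_tensor_sumr !raddf_sum; apply: eq_bigr => p _; apply: fg.
Qed.

End TripleTensors.

Variable m : nat.
Hypothesis m_gt0 : (0 < m)%N.
Local Notation C := (truncpoly k m).
Local Notation y := ('qX : C).

Lemma mk_monic_Xm : mk_monic ('X^m : {poly k}) = 'X^m.
Proof. by case: m m_gt0 => // m' _; rewrite mk_monic_Xn. Qed.

Lemma qXnE r : y ^+ r = in_qpoly 'X^m 'X^r.
Proof. by rewrite rmorphXn. Qed.

Lemma qXn_eq0 r : (m <= r)%N -> y ^+ r = 0.
Proof.
move=> le_mr; rewrite -(subnK le_mr) exprD.
suff -> : y ^+ m = 0 by rewrite mulr0.
rewrite qXnE; apply/val_inj => /=; rewrite mk_monic_Xm.
by rewrite Pdiv.RingMonic.rmodpp // monicXn.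
Qed.

Lemma coef_qXn r j : (r < m)%N -> (y ^+ r)`_j = (j == r)%:R.
Proof.
move=> lt_rm; rewrite qXnE in_qpoly_small ?coefXn //.
by rewrite mk_monic_Xm !size_polyXn.
Qed.

Lemma truncpoly_sum (c : C) : c = \sum_(r < m) c`_r *: y ^+ r.
Proof.
apply/val_inj/polyP => j; rewrite coefn_sum.
have [lt_jm | le_mj] := ltnP j m.
  rewrite (bigD1 (Ordinal lt_jm)) //= coefZ coef_qXn // eqxx mulr1.
  rewrite big1 ?addr0 //.
  by move=> r /negPf ne; rewrite coefZ coef_qXn // eq_sym [_ == _]ne mulr0.
rewrite big_coef_npoly ?mk_monic_Xm ?size_polyXn // big1 // => r _.
by rewrite coefZ coef_qXn // gtn_eqF ?mulr0 // (leq_trans (ltn_ord r)).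
Qed.

Variable M : lmodType k.

Lemma tensor_coef_bilinear j : is_bilinear (fun (a : M) (c : C) => c`_j *: a).
Proof.
split=> [c x a b|a x c d] /=; first by rewrite scalerDr !scalerA mulrC.
by rewrite coefD coefZ scalerDl scalerA.
Qed.

(** The powers of y form a basis of k[y]/<y^m>; the coefficient of y^i is read
    off by the linear map a (x) c |-> c_i a. *)
Lemma tensor_basis_inj (E D : nat -> M) :
  \sum_(j < m) E j ⊗ (y ^+ j) = \sum_(j < m) D j ⊗ (y ^+ j) ->
  forall j, (j < m)%N -> E j = D j.
Proof.
move=> eqED i lt_im.
pose coef_i (a : M) (c : C) := c`_i *: a.
have coefE (B : nat -> M) :
    tensor_lift coef_i (\sum_(j < m) B j ⊗ (y ^+ j)) = B i.
  pose L : {linear M ⊗[k] C -> M} := HB.pack (tensor_lift coef_i)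
    (GRing.isLinear.Build k _ _ _ _
      (tensor_lift_linear (tensor_coef_bilinear i))).
  rewrite -[tensor_lift _]/(L : _ -> _) raddf_sum /=.
  rewrite (bigD1 (Ordinal lt_im)) //= (tensor_liftE (tensor_coef_bilinear i)).
  rewrite coef_qXn // eqxx scale1r big1 ?addr0 // => j /negPf ne.
  rewrite (tensor_liftE (tensor_coef_bilinear i)) coef_qXn //.
  by rewrite eq_sym [_ == _]ne scale0r.
by rewrite -coefE eqED coefE.
Qed.

End TensorTruncPoly.

(** * Twisting maps as coefficient families *)

Local Arguments tensor_map : simpl never.
Local Arguments tensor_assoc : simpl never.
Local Arguments tensor_assocV : simpl never.
Local Arguments tensor_mul : simpl never.
Local Arguments pow_coef : simpl never.

Section TensorMapSums.
Variables (k : comNzRingType) (M N P M' N' : lmodType k).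
Variables (I : Type) (r : seq I).

Lemma tensor_map_sum (f : {linear M -> M'}) (g : {linear N -> N'})
    (E : I -> M ⊗[k] N) :
  tensor_map f g (\sum_(i <- r) E i) = \sum_(i <- r) tensor_map f g (E i).
Proof. exact: raddf_sum. Qed.

Lemma tensor_assoc_sum (E : I -> (M ⊗[k] N) ⊗[k] P) :
  tensor_assoc (\sum_(i <- r) E i) = \sum_(i <- r) tensor_assoc (E i).
Proof. exact: raddf_sum. Qed.

Lemma tensor_assocV_sum (E : I -> M ⊗[k] (N ⊗[k] P)) :
  tensor_assocV (\sum_(i <- r) E i) = \sum_(i <- r) tensor_assocV (E i).
Proof. exact: raddf_sum. Qed.

End TensorMapSums.

Section TwistingMaps.
Variables (k : comNzRingType) (A : algType k) (m : nat).
Hypothesis m_gt1 : (1 < m)%N.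
Local Notation C := (truncpoly k m).
Local Notation y := ('qX : C).
Let m_gt0 : (0 < m)%N := ltnW m_gt1.

Section Family.
Variables (s : {linear C ⊗[k] A -> A ⊗[k] C}).
Variables (G : nat -> nat -> {linear A -> A}).
Hypothesis sE : forall r a, (r < m)%N ->
  s (y ^+ r ⊗ a) = \sum_(j < m) G r j a ⊗ (y ^+ j).

(** The right-hand sides of the two compatibility axioms of a twisting map, on
    the generators y^r and y^t and in terms of the family of s. *)
Lemma twist_hexagonC r t a : (r < m)%N -> (t < m)%N ->
  (tensor_map idfun (mu C) \o @tensor_assoc k A C C
     \o tensor_map s idfun \o @tensor_assocV k C A C
     \o tensor_map idfun s \o @tensor_assoc k C C A)
    ((y ^+ r ⊗ y ^+ t) ⊗ a) =
  \sum_(j < m) (\sum_(l < j.+1) G r l (G t (j - l) a)) ⊗ (y ^+ j).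
Proof.
move=> ltrm lttm; rewrite /= tensor_assocE tensor_mapE /= sE //.
rewrite pure_tensor_sumr tensor_assocV_sum (tensor_map_sum _ s).
rewrite tensor_assoc_sum tensor_map_sum.
pose T l j := G r l (G t j a) ⊗ (y ^+ (l + j)).
transitivity (\sum_(j < m) \sum_(l < j.+1) T l (j - l)%N); last first.
  apply: eq_bigr => j _; rewrite pure_tensor_suml; apply: eq_bigr => l _.
  by rewrite /T subnKC // -ltnS.
rewrite (sum_antidiagonals m T).
transitivity (\sum_(j < m) \sum_(l < m) T l j).
  apply: eq_bigr => j _; rewrite tensor_assocVE tensor_mapE sE //=.
  rewrite pure_tensor_suml tensor_assoc_sum tensor_map_sum.
  apply: eq_bigr => l _.
  by rewrite tensor_assocE tensor_mapE /= tensor_mulE -exprD.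
rewrite exchange_big; apply: eq_bigr => l _ /=.
rewrite [RHS](big_ord_widen m (T l)) ?leq_subr // [RHS]big_mkcond.
apply: eq_bigr => j _ /=; case: ifP => // le.
by rewrite /T qXn_eq0 ?pure_tensor0r //; lia.
Qed.

Lemma twist_hexagonA r a b : (r < m)%N ->
  (tensor_map (mu A) idfun \o @tensor_assocV k A A C
     \o tensor_map idfun s \o @tensor_assoc k A C A
     \o tensor_map s idfun \o @tensor_assocV k C A A) (y ^+ r ⊗ (a ⊗ b)) =
  \sum_(j < m) (\sum_(i < m) G r i a * G i j b) ⊗ (y ^+ j).
Proof.
move=> ltrm; rewrite /= tensor_assocVE tensor_mapE sE //= pure_tensor_suml.
rewrite tensor_assoc_sum (tensor_map_sum _ _ s).
rewrite tensor_assocV_sum tensor_map_sum.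
transitivity (\sum_(i < m) \sum_(j < m) (G r i a * G i j b) ⊗ (y ^+ j)).
  apply: eq_bigr => i _; rewrite tensor_assocE tensor_mapE sE //=.
  rewrite pure_tensor_sumr tensor_assocV_sum tensor_map_sum.
  apply: eq_bigr => j _.
  by rewrite tensor_assocVE tensor_mapE /= tensor_mulE.
by rewrite exchange_big; apply: eq_bigr => j _; rewrite pure_tensor_suml.
Qed.

End Family.

(** Applying the axiom for the product of k[y]/<y^m> to y * y^r identifies
    gamma^(r+1) with g gamma^r, as long as r + 1 < m; the axioms for the unit
    and the product of A then need only be read at y. *)
Lemma upper_twist_coefs_of_map (s : {linear C ⊗[k] A -> A ⊗[k] C})
    (gamma : nat -> nat -> {linear A -> A}) :
  twisting_map s -> associated_family s gamma -> upper_triangular gamma ->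
  upper_twist_coefs (gamma 1%N) m.
Proof.
move=> [[s1A sC1] sMC sMA] [sE _] g0.
have gE r j : (r < m)%N -> (j < m)%N -> gamma r j =1 pow_coef (gamma 1%N) r j.
  elim: r j => [|r IHr] j ltrm ltjm a.
    apply: (tensor_basis_inj m_gt0 (E := fun j => gamma 0%N j a)
      (D := fun j => a *+ (j == 0)%N)) => //.
    rewrite -sE // expr0 s1A (bigD1 (Ordinal m_gt0)) //= expr0 big1 ?addr0 //.
    move=> [[|i] ltim] //= _.
    by rewrite mulr0n pure_tensor0l.
  apply: (tensor_basis_inj m_gt0 (E := fun j => gamma r.+1 j a)
    (D := fun j => pow_coef (gamma 1%N) r.+1 j a)) => //.
  rewrite -sE // exprS -tensor_mulE.
  have := sMC ((y ^+ 1 ⊗ y ^+ r) ⊗ a).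
  rewrite (twist_hexagonC sE) ?(ltnW ltrm) //.
  rewrite /= tensor_mapE /= => ->; apply: eq_bigr => i _.
  congr (_ ⊗ _); apply: eq_bigr => l _.
  by rewrite IHr ?(ltnW ltrm) // (leq_ltn_trans (leq_subr _ _)).
split=> // [j ltjm | j a b ltjm].
  apply: (tensor_basis_inj m_gt0 (E := fun j => gamma 1%N j 1)
    (D := fun j => (j == 1)%:R)) => //.
  rewrite -sE // expr1 sC1 (bigD1 (Ordinal m_gt1)) //= expr1 big1 ?addr0 //.
  move=> i; rewrite -val_eqE /= => /negPf->.
  by rewrite pure_tensor0l.
rewrite (@sum_pow_coef_widen _ _ _ g0 m j (fun i => gamma 1%N i a)) //.
apply: (tensor_basis_inj m_gt0 (E := fun j => gamma 1%N j (a * b))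
  (D := fun j => \sum_(i < m) gamma 1%N i a * pow_coef (gamma 1%N) i j b))
  => //.
rewrite -sE // -tensor_mulE.
have := sMA (y ^+ 1 ⊗ (a ⊗ b)); rewrite (twist_hexagonA sE) //.
rewrite /= tensor_mapE /= => ->; apply: eq_bigr => i _.
congr (_ ⊗ _); apply: eq_bigr => l _.
by congr (_ * _); apply: gE.
Qed.

Section Extensionality.
Variable Q : lmodType k.

Lemma monomials_ext2 (f h : {linear (C ⊗[k] C) ⊗[k] A -> Q}) :
  (forall r t a, (r < m)%N -> (t < m)%N ->
     f ((y ^+ r ⊗ y ^+ t) ⊗ a) = h ((y ^+ r ⊗ y ^+ t) ⊗ a)) -> f =1 h.
Proof.
move=> fh; apply: linear_tensor3_ext => c d a.
rewrite (truncpoly_sum m_gt0 c) (truncpoly_sum m_gt0 d) !pure_tensor_suml.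
rewrite !raddf_sum.
apply: eq_bigr => r _; rewrite !pure_tensor_sumr !pure_tensor_suml !raddf_sum.
apply: eq_bigr => t _; rewrite pure_tensorZl pure_tensorZr !pure_tensorZl.
by rewrite scalerA [LHS]linearZ [RHS]linearZ fh.
Qed.

Lemma monomials_ext1 (f h : {linear C ⊗[k] (A ⊗[k] A) -> Q}) :
  (forall r a b, (r < m)%N ->
     f (y ^+ r ⊗ (a ⊗ b)) = h (y ^+ r ⊗ (a ⊗ b))) -> f =1 h.
Proof.
move=> fh; apply: linear_tensor3r_ext => c a b.
rewrite (truncpoly_sum m_gt0 c) !pure_tensor_suml !raddf_sum.
by apply: eq_bigr => r _; rewrite pure_tensorZl [LHS]linearZ [RHS]linearZ fh.
Qed.

End Extensionality.

Section Construction.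
Variable g : nat -> {linear A -> A}.

Definition twist_fun (c : C) (a : A) : A ⊗[k] C :=
  \sum_(j < m) (\sum_(r < m) c`_r *: pow_coef g r j a) ⊗ (y ^+ j).

Fact twist_fun_bilinear : is_bilinear twist_fun.
Proof.
split=> [a x c d|c x a b]; rewrite /twist_fun scaler_sumr -big_split;
  apply: eq_bigr => j _ /=;
  rewrite -pure_tensorZl -pure_tensorDl scaler_sumr -big_split;
  congr (_ ⊗ _); apply: eq_bigr => r _ /=.
  by rewrite coefD coefZ scalerDl scalerA.
by rewrite linearP scalerDr !scalerA mulrC.
Qed.

Definition twist_of_coefs : C ⊗[k] A -> A ⊗[k] C := tensor_lift twist_fun.

HB.instance Definition _ := GRing.isLinear.Build k _ _ _ twist_of_coefs
  (tensor_lift_linear twist_fun_bilinear).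

Hypothesis gP : upper_twist_coefs g m.
Let g0 : g 0%N =1 \0 := let: And3 h _ _ := gP in h.

(** This holds for every r, not only r < m: for r >= m the left-hand side is 0
    because y^r = 0, the right-hand side because [g^r]_j = 0 when j < r. *)
Lemma twist_of_coefsE r a :
  twist_of_coefs (y ^+ r ⊗ a) = \sum_(j < m) pow_coef g r j a ⊗ (y ^+ j).
Proof.
rewrite /twist_of_coefs (tensor_liftE twist_fun_bilinear).
apply: eq_bigr => j _; congr (_ ⊗ _).
have [ltrm | lemr] := ltnP r m.
  rewrite (bigD1 (Ordinal ltrm)) //= coef_qXn // eqxx scale1r big1 ?addr0 //.
  by move=> i /negPf ne; rewrite coef_qXn // [_ == _]ne scale0r.
rewrite pow_coef_eq0 ?(leq_trans (ltn_ord j)) // big1 // => i _.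
by rewrite qXn_eq0 // coef0 scale0r.
Qed.

Lemma twisting_map_of_coefs : twisting_map twist_of_coefs.
Proof.
split.
- split=> [a|c].
    rewrite -[LHS]/(twist_of_coefs (y ^+ 0 ⊗ a)) twist_of_coefsE.
    rewrite (bigD1 (Ordinal m_gt0)) //= expr0 big1 ?addr0 //.
    move=> [[|i] ltim] //= _.
    by rewrite pow_coef0E /= mulr0n pure_tensor0l.
  transitivity (twist_fun c 1); first exact: (tensor_liftE twist_fun_bilinear).
  rewrite [in RHS](truncpoly_sum m_gt0 c).
  rewrite pure_tensor_sumr; apply: eq_bigr => j _.
  rewrite pure_tensorZr -pure_tensorZl; congr (_ ⊗ _).
  rewrite (bigD1 j) //= (pow_coef_one gP) ?ltn_addr // eqxx big1 ?addr0 //.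
  move=> r /negPf ne; rewrite (pow_coef_one gP) ?ltn_addr //.
  by rewrite [_ == _]ne scaler0.
- apply: monomials_ext2 => r t a ltrm lttm.
  apply: etrans
    (esym (twist_hexagonC (fun r a _ => twist_of_coefsE r a) a ltrm lttm)).
  rewrite /= tensor_mapE /= tensor_mulE -exprD twist_of_coefsE.
  by apply: eq_bigr => j _; rewrite pow_coefD.
apply: monomials_ext1 => r a b ltrm.
apply: etrans
  (esym (twist_hexagonA (fun r a _ => twist_of_coefsE r a) a b ltrm)).
rewrite /= tensor_mapE /= tensor_mulE twist_of_coefsE.
apply: eq_bigr => j _; rewrite (pow_coefM gP) ?ltn_addr //.
by rewrite (@sum_pow_coef_widen _ _ _ g0 m j (fun i => pow_coef g r i a)).
Qed.

Lemma associated_family_of_coefs :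
  associated_family twist_of_coefs (fun r j => pow_coef g r j).
Proof.
split=> [r a _ | r j lemr ltjm a]; first exact: twist_of_coefsE.
by apply: pow_coef_eq0 => //; apply: leq_trans lemr.
Qed.

End Construction.
End TwistingMaps.

(** * The obstruction to adding one more coefficient *)

Section ObstructionTerms.
Variables (k : comNzRingType) (A : algType k) (n : nat).
Hypothesis n_ge2 : (2 <= n)%N.
Implicit Types g : nat -> {linear A -> A}.

Lemma sum_from2 (E : nat -> A) :
  \sum_(0 <= i < n) E i = E 0%N + E 1%N + \sum_(2 <= i < n) E i.
Proof. by rewrite big_ltn ?(ltn_trans _ n_ge2) // big_ltn // addrA. Qed.

(** The obstruction F(a (x) b), with the sums over compositions written as
    coefficients of powers. *)
Definition middle_sum g (a b : A) : A :=
  \sum_(2 <= i < n) g i a * pow_coef g i n b.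

Lemma sum_split_middle g a b : g 0%N =1 \0 ->
  \sum_(i < n.+1) g i a * pow_coef g i n b =
  g 1%N a * g n b + middle_sum g a b + g n a * pow_coef g n n b.
Proof.
move=> g0; rewrite -(big_mkord xpredT (fun i => g i a * pow_coef g i n b)).
rewrite big_nat_recr //= sum_from2.
by rewrite g0 mul0r add0r pow_coef1E.
Qed.

(** The only terms of the sum at j = n that contain g_n are those with i = 1
    and i = n, so the product rule for g_n is a single equation with an
    inhomogeneous term that depends on g_2, ..., g_(n-1) alone besides
    alpha. *)
Lemma upper_twist_coefsS g :
  upper_twist_coefs g n.+1 <->
  [/\ upper_twist_coefs g n, g n 1 = 0
    & forall a b, g n (a * b) =
        g 1%N a * g n b + middle_sum g a b + g n a * pow_coef g n n b].
Proof.
split=> [[g0 g1 gM] | [[g0 g1 gM] gn1 gnM]].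
  split=> [|| a b]; last by rewrite gM ?sum_split_middle.
    by split=> // [j ltjn | j a b ltjn]; rewrite ?g1 ?gM // ltnW.
  by rewrite g1 // gtn_eqF.
split=> // [j | j a b]; rewrite ltnS leq_eqVlt => /orP[/eqP-> | ltjn].
- by rewrite gn1 gtn_eqF.
- exact: g1.
- by rewrite gnM sum_split_middle.
exact: gM.
Qed.

Lemma upper_twist_coefs_congr g g' : (forall j, (j < n)%N -> g j =1 g' j) ->
  upper_twist_coefs g n -> upper_twist_coefs g' n.
Proof.
have n_gt0 : (0 < n)%N := ltnW n_ge2.
move=> eqg [g0 g1 gM]; split=> [a | j ltjn | j a b ltjn].
- by rewrite -eqg.
- by rewrite -eqg ?g1.
rewrite -eqg // gM //; apply: eq_bigr => i _.
have lein : (i < n)%N by apply: leq_ltn_trans ltjn; rewrite -ltnS.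
by rewrite eqg // (pow_coef_congr g0 eqg) // ltn_addr.
Qed.

Lemma middle_sum_congr g g' a b : g 0%N =1 \0 ->
  (forall j, (j < n)%N -> g j =1 g' j) -> middle_sum g a b = middle_sum g' a b.
Proof.
have n_gt0 : (0 < n)%N := ltnW n_ge2.
move=> g0 eqg; apply: eq_big_nat => i /andP[ge2i ltin].
by rewrite eqg // (pow_coef_congr g0 eqg) // ge2i addn1.
Qed.

Section Cocycle.
Variable g : nat -> {linear A -> A}.
Hypothesis gP : upper_twist_coefs g n.
Let g0 : g 0%N =1 \0 := let: And3 h _ _ := gP in h.

Lemma middle_sum_1l b : middle_sum g 1 b = 0.
Proof.
case: gP => _ g1 _; rewrite /middle_sum big_nat big1 // => i /andP[ge2i ltin].
by rewrite g1 // gtn_eqF // mul0r.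
Qed.

Lemma middle_sum_1r a : middle_sum g a 1 = 0.
Proof.
rewrite /middle_sum big_nat big1 // => i /andP[ge2i ltin].
by rewrite (pow_coef_one gP) ?ge2i ?addn1 // ltn_eqF // mulr0.
Qed.

(** Expand [g^i]_n(b c) by [pow_coefM], which is allowed as i >= 2, and collect
    the terms by the index t of [g^t]_n(c). For t < n the inner sum over i is
    the product rule of g_t without its term i = 1; for t = n it is F(a, b). *)
Lemma middle_sumMr a b c :
  middle_sum g a (b * c) =
  \sum_(2 <= t < n) (g t (a * b) - g 1%N a * g t b) * pow_coef g t n c +
  middle_sum g a b * pow_coef g n n c.
Proof.
have partial t : \sum_(i < n) g i a * pow_coef g i t b =
    g 1%N a * g t b + \sum_(2 <= i < n) g i a * pow_coef g i t b.
  rewrite -(big_mkord xpredT (fun i => g i a * pow_coef g i t b)).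
  by rewrite sum_from2 g0 mul0r add0r pow_coef1E.
transitivity (\sum_(0 <= t < n.+1)
    (\sum_(2 <= i < n) g i a * pow_coef g i t b) * pow_coef g t n c).
  under [RHS]eq_bigr => t _ do rewrite mulr_suml.
  rewrite exchange_big /=; apply: eq_big_nat => i /andP[ge2i ltin].
  rewrite (pow_coefM gP) ?ge2i ?addn1 // mulr_sumr big_mkord.
  by apply: eq_bigr => t _; rewrite mulrA.
have vanish t : (t < 2)%N -> \sum_(2 <= i < n) g i a * pow_coef g i t b = 0.
  move=> lt2; rewrite big_nat big1 // => i /andP[ge2i _].
  by rewrite pow_coef_eq0 ?mulr0 // (leq_trans lt2).
rewrite big_nat_recr //= sum_from2.
rewrite (vanish 0%N) // (vanish 1%N) // !mul0r !add0r; congr (_ + _).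
apply: eq_big_nat => t /andP[ge2t lttn]; congr (_ * _).
case: gP => _ _ gM.
rewrite gM // (@sum_pow_coef_widen _ _ _ g0 n t (fun i => g i a)) //.
by rewrite partial addrC addrA addNr add0r.
Qed.

(** The two halves of the sum over t in [middle_sumMr] are F(a b, c) and
    alpha(a) F(b, c), and its last term is F(a, b) alpha^n(c). *)
Lemma middle_sum_cocycle a b c :
  g 1%N a * middle_sum g b c - middle_sum g (a * b) c
  + middle_sum g a (b * c) - middle_sum g a b * pow_coef g n n c = 0.
Proof.
rewrite middle_sumMr addrA addrK.
under [X in _ + X]eq_bigr => t _ do rewrite mulrBl -mulrA.
by rewrite sumrB -mulr_sumr -!/(middle_sum g _ _) addrA subrK subrr.
Qed.

End Cocycle.
End ObstructionTerms.

Theorem theorem4p1 (k : comNzRingType) (A : algType k) (n : nat)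
  (n_ge2 : (2 <= n)%N)
  (s : {linear truncpoly k n ⊗[k] A -> A ⊗[k] truncpoly k n})
  (gamma : nat -> nat -> {linear A -> A})
  (s_twisting : twisting_map s)
  (s_family : associated_family s gamma)
  (s_upper : upper_triangular gamma) :
  let alpha : {linear A -> A} := gamma 1%N 1%N in
  let alphan : {linear A -> A} := lin_iter n alpha in
  let F : {linear A ⊗[k] A -> A} := obstruction gamma n in
  [/\ normalized2 F,
      cocycle2 alpha alphan F,
      (exists (s' : {linear truncpoly k n.+1 ⊗[k] A ->
                             A ⊗[k] truncpoly k n.+1})
              (gamma' : nat -> nat -> {linear A -> A}),
         upper_triangular_extension gamma s' gamma')
      <-> null_class2 alpha alphan F
    & forall (s' : {linear truncpoly k n.+1 ⊗[k] A ->
                            A ⊗[k] truncpoly k n.+1})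
             (gamma' : nat -> nat -> {linear A -> A}),
        upper_triangular_extension gamma s' gamma' ->
        F =1 \- hoch_b2 alpha alphan (gamma' 1%N n)].
Proof.
move=> alpha alphan F; set g := gamma 1%N.
have gP : upper_twist_coefs g n.
  exact: upper_twist_coefs_of_map s_twisting s_family s_upper.
have g0 : g 0%N =1 \0 := s_upper.
have FE a b : F (a ⊗ b) = middle_sum n g a b.
  rewrite [LHS]obstructionE; apply: eq_bigr => i _.
  by rewrite gamma_topE.
have alphanE a : alphan a = pow_coef g n n a by rewrite pow_coef_diag.
have n_gt0 : (0 < n)%N := ltnW n_ge2.
have ext_coboundary (s' : {linear truncpoly k n.+1 ⊗[k] A ->
    A ⊗[k] truncpoly k n.+1}) gamma' :
    upper_triangular_extension gamma s' gamma' ->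
    F =1 \- hoch_b2 alpha alphan (gamma' 1%N n).
  case=> s'_tw s'_fam s'_up eqg.
  have eqg' j : (j < n)%N -> g j =1 gamma' 1%N j.
    by move=> ltjn a; exact: esym (eqg j ltjn a).
  have /(upper_twist_coefs_of_map (leqW n_ge2) s'_tw s'_fam) := s'_up.
  move/(upper_twist_coefsS n_ge2) => [_ _ gnM].
  apply: linear_tensor_ext => a b.
  transitivity (- hoch_b2 alpha alphan (gamma' 1%N n) (a ⊗ b)) => //.
  rewrite FE hoch_b2E gnM alphanE.
  rewrite (pow_coef_congr g0 eqg') // ?n_ge2 ?addn1 //.
  rewrite -(middle_sum_congr n_ge2 a b g0 eqg') (eqg 1%N) //.
  by rewrite opprD opprB [RHS]addrAC addrK addrC addKr.
split=> //.
- by move=> a; rewrite !FE (middle_sum_1l gP) (middle_sum_1r gP).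
- apply: linear_tensor3r_ext => a b c.
  by rewrite [LHS]hoch_b3E !FE alphanE (middle_sum_cocycle n_ge2 gP).
split=> [[s' [gamma' /ext_coboundary FE']] | [d Fd]].
  exists (\- gamma' 1%N n : {linear A -> A}) => t.
  rewrite {}FE'; move: t; apply: linear_tensor_ext => a b.
  transitivity (- hoch_b2 alpha alphan (gamma' 1%N n) (a ⊗ b)) => //.
  by rewrite !hoch_b2E /= mulrN mulNr !opprD.
(* F = b^2(d) means F = - b^2(- d), so the new coefficient is - d *)
pose dN : {linear A -> A} := \- d.
pose g' (j : nat) := if (j == n)%N then dN else g j.
have eqg j : (j < n)%N -> g j =1 g' j by move=> ltjn a; rewrite /g' ltn_eqF.
have d1 : d 1 = 0.
  have := Fd (1 ⊗ 1); rewrite hoch_b2E FE (middle_sum_1l gP).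
  have [_ g1 _] := gP; rewrite alphanE (pow_coef_one gP) ?n_ge2 ?addn1 //.
  by rewrite eqxx !mulr1 /alpha g1 // eqxx mul1r subrr add0r => <-.
have g'P : upper_twist_coefs g' n.+1.
  apply/(upper_twist_coefsS n_ge2); split.
  - exact: upper_twist_coefs_congr eqg gP.
  - by rewrite /g' eqxx /= d1 oppr0.
  move=> a b; rewrite -(middle_sum_congr n_ge2 a b g0 eqg) -FE Fd hoch_b2E.
  rewrite -(pow_coef_congr g0 eqg) ?n_ge2 ?addn1 // -alphanE -(eqg 1%N) //.
  by rewrite /g' eqxx /= mulrN mulNr !addrA addrK addNr add0r.
exists (@twist_of_coefs k A n.+1 g'), (fun r j => pow_coef g' r j).
have n1_gt1 : (1 < n.+1)%N by rewrite ltnW.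
split.
- exact: twisting_map_of_coefs.
- exact: associated_family_of_coefs.
- by move=> a; rewrite [LHS]pow_coef1E; case: g'P.
by move=> j ltjn a; rewrite [LHS]pow_coef1E -eqg.
Qed.
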